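(* Let $T_R$ denote a quantile clock that satisfies $T_R(t)\stackrel{d}{=}\zeta_1(t)$ for each fixed $t$, for some subordinator $\zeta_1$. Furthermore, let $\zeta_2$ denote a subordinator independent of $T_R$ and $\zeta_1$. Then for each fixed $t$ $$T_R(\zeta_2(t))\stackrel{d}{=}\zeta_1(\zeta_2(t))\qquad\text{and}\qquad\zeta_2(T_R(t))\stackrel{d}{=}\zeta_2(\zeta_1(t)).$$
   Context: A subordinator is an increasing right-continuous process started at $0$ with stationary independent increments and zero drift. Quantile clock with parameters $(R,L)$: $R$ is a positive random variable with continuous strictly increasing (on its support) c.d.f. $F_R$ and $\mathbb{E}[R]<\infty$, $Q_R(u)=\inf\{t:F_R(t)\ge u\}$, $L$ is an infinite activity subordinator (infinite total Lévy mass), and $T_R(t)=\int_0^tQ_R((1-s/t)_+)L(ds)$, $t\ge0$, $(a)_+=\max(0,a)$. *)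

(* Defs.v *)
From HB Require Import structures.
From mathcomp Require Import all_boot all_order all_algebra.
From mathcomp Require Import all_classical all_reals all_analysis.
From mathcomp Require Import measurable_realfun.

Set Implicit Arguments.
Unset Strict Implicit.
Unset Printing Implicit Defensive.

Import Order.TTheory GRing.Theory Num.Theory.
Import numFieldNormedType.Exports.

Local Open Scope classical_set_scope.
Local Open Scope ring_scope.

(* Measurability is part of the definition: [P] is only meaningful on
   measurable sets, and the maps compared below (e.g. a process evaluated at a
   random time) are not random variables by construction. *)
Definition eq_dist {d d'} {T : measurableType d} {U : measurableType d'}
    {R : realType} (P : probability T R) (X Y : T -> U) : Prop :=
  [/\ measurable_fun [set: T] X, measurable_fun [set: T] Y &
      forall B, measurable B -> P (X @^-1` B) = P (Y @^-1` B)].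

(* A process is a map [R -> T -> U] of which only the times [t >= 0] matter. *)
Definition process_sigma_algebra {d d'} {T : measurableType d}
    {U : measurableType d'} {R : realType} (X : R -> T -> U) : set (set T) :=
  <<s [set A | exists (t : R) B, [/\ 0 <= t, measurable B & A = X t @^-1` B]] >>.

Definition independent_processes {d d1 d2} {T : measurableType d}
    {U : measurableType d1} {V : measurableType d2} {R : realType}
    (P : probability T R) (X : R -> T -> U) (Y : R -> T -> V) : Prop :=
  forall A B, process_sigma_algebra X A -> process_sigma_algebra Y B ->
    P (A `&` B) = (P A * P B)%E.

Section levy.
Context {d} {T : measurableType d} {R : realType}.
Variables (P : probability T R) (X : R -> T -> R).

Definition increment (s t : R) : T -> R := fun w => X t w - X s w.

Definition stationary_increments : Prop :=
  forall s t : R, 0 <= s -> 0 <= t ->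
    eq_dist P (increment s (s + t)) (increment 0 t).

Definition independent_increments : Prop :=
  forall (n : nat) (t : nat -> R) (B : nat -> set R),
    0 <= t 0%N -> (forall i, t i <= t i.+1) -> (forall i, measurable (B i)) ->
    P (\bigcap_(i < n) (increment (t i) (t i.+1) @^-1` B i)) =
    (\prod_(i < n) P (increment (t i) (t i.+1) @^-1` B i))%E.

(* [b] is the drift and [nu] the Levy measure in the Levy-Khintchine formula
   E[exp(-u X_t)] = exp(-t (b u + \int_(0,oo) (1 - exp(-u x)) nu(dx))). *)
Definition levy_khintchine (b : R)
    (nu : {measure set (measurableTypeR R) -> \bar R}) : Prop :=
  [/\ nu `]-oo, 0]%classic = 0%E,
      (\int[nu]_(x in `]0%R, +oo[) (Num.min 1 (x : R))%:E < +oo)%E &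
      forall t u : R, 0 <= t -> 0 <= u ->
        ('E_P[fun w => expR (- (u * X t w))%R])%E =
        (expR (- (t * (b * u +
           \int[nu]_(x in `]0, +oo[) (1 - expR (- (u * x)))))))%:E].

Definition zero_drift : Prop := exists nu, levy_khintchine 0 nu.

Definition infinite_activity : Prop :=
  exists b nu, levy_khintchine b nu /\ nu `]0, +oo[%classic = +oo%E.

End levy.

(* The requirements on paths hold for every outcome, so that [quantile_clock]
   below can be a pathwise integral. *)
Record subordinator {d} {T : measurableType d} {R : realType}
    (P : probability T R) := Subordinator {
  process :> R -> T -> R ;
  process_measurable : forall t : R, 0 <= t -> measurable_fun [set: T] (process t) ;
  process0 : forall w, process 0 w = 0 ;
  process_nondecreasing : forall w (s t : R), 0 <= s -> s <= t ->
    process s w <= process t w ;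
  process_right_continuous : forall w (t : R), 0 <= t ->
    process s w @[s --> t^'+] --> process t w ;
  process_stationary : stationary_increments P process ;
  process_independent : independent_increments P process ;
  process_zero_drift : zero_drift P process }.

Section path.
Context {d} {T : measurableType d} {R : realType} {P : probability T R}.
Variables (L : subordinator P) (w : T).

(* The path of [L], extended by its initial value 0 to negative times. *)
Definition path_of (s : R) : R := L (Num.max 0 s) w.

Let path_of_nd : {homo path_of : x y / x <= y}.
Proof.
move=> x y xy; apply: process_nondecreasing.
  by rewrite le_max lexx.
by rewrite ge_max !le_max lexx xy orbT.
Qed.

Let path_of_rc : right_continuous path_of.
Proof.
move=> x; have [x0|x0] := leP 0 x.
  have -> : path_of x = L x w by rewrite /path_of max_r.
  refine (cvg_trans _ (@process_right_continuous _ _ _ _ L w x x0)).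
  apply: near_eq_cvg; near=> s; rewrite /path_of max_r//; apply: (le_trans x0); near: s.
  exact: nbhs_right_ge.
have -> : path_of x = L 0 w by rewrite /path_of max_l// ltW.
apply: cvg_near_cst; near=> s.
rewrite /path_of max_l//; apply: ltW; near: s.
exact: nbhs_right_lt.
Unshelve. all: by end_near. Qed.

HB.instance Definition _ :=
  isCumulative.Build R _ R path_of path_of_nd path_of_rc.

End path.

Section quantile_clock.
Context {d d'} {S : measurableType d} {T : measurableType d'} {R : realType}.
Context {Q : probability S R} {P : probability T R}.

Definition law_support (X : {RV Q >-> R}) : set R :=
  [set x | forall e, 0 < e -> (0 < distribution Q X (ball x e))%E].

(* Generalized inverse of a c.d.f. of a positive random variable, viewed as a
   function on [0, +oo[, so that [quantile F 0 = 0]. It is +oo at [u = 1] if the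
   support is unbounded. *)
Definition quantile (F : R -> \bar R) (u : R) : \bar R :=
  ereal_inf [set x%:E | x in [set x | 0 <= x /\ (u%:E <= F x)%E]].

(* The law of [X] (on an arbitrary probability space) is the parameter R. *)
Record quantile_clock_parameters (X : {RV Q >-> R}) (L : subordinator P)
    : Prop := QuantileClockParameters {
  qc_positive : {ae Q, forall w, 0 < X w} ;
  qc_continuous : continuous (cdf X) ;
  qc_increasing : {in law_support X &, {homo cdf X : x y / x < y >-> (x < y)%E}} ;
  qc_expectation : ('E_Q[X] < +oo)%E ;
  qc_activity : infinite_activity P L }.

(* Pathwise Lebesgue-Stieltjes integral over ]0, t]. It is a priori only
   extended-real valued: it may be infinite on a negligible event. *)
Definition quantile_clock (X : {RV Q >-> R}) (L : subordinator P) (t : R) (w : T)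
    : \bar R :=
  (\int[lebesgue_stieltjes_measure (path_of L w)]_(s in `]0%R, t])
    quantile (cdf X) (Num.max 0 (1 - (s : R) / t))%R)%E.

End quantile_clock.

(* Main.v *)
Require Import Defs.
From HB Require Import structures.
From mathcomp Require Import all_boot all_order all_algebra.
From mathcomp Require Import all_classical all_reals all_analysis.
From mathcomp Require Import measurable_realfun.

Set Implicit Arguments.
Unset Strict Implicit.
Unset Printing Implicit Defensive.

Import Order.TTheory GRing.Theory Num.Theory.
Import numFieldNormedType.Exports.

Local Open Scope classical_set_scope.
Local Open Scope ring_scope.

(** Conditionally on an independent random time [Y = z], a process sampled at
    [Y] has the law of its value at the fixed time [z]; hence the law of
    [f (Y w) w] is determined by the law of [Y] and the one-dimensional
    marginals of [f]. Both identities follow: in the first the time is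
    [zeta2 t] on both sides and the two processes have the same marginals by
    hypothesis; in the second the process is [zeta2] on both sides and the two
    times have the same law by hypothesis.

    Conditioning is made rigorous by [law_independent_substitution]: when [Y]
    and [V] are independent the law of [(Y, V)] is a product measure, so the law
    of [h (Y, V)] is the mixture over [z] of the laws of [h (z, V)]. It is
    applied with [V] the identity of the probability space, seen as a random
    element of that same space carrying the smaller sigma-algebra generated by
    the process ([process_space]), and [h] the evaluation of the process. This
    requires the evaluation to be measurable in the pair (time, outcome), where
    path regularity is used.

    A subordinator is monotone and right-continuous in time, so the evaluation
    is controlled by countably many rational times
    ([jointly_measurable_right]). A quantile clock is monotone and
    left-continuous ([jointly_measurable_left]). Left-continuity holds on every
    path: the integrand [quantile F (max 0 (1 - s / t))] increases with [t]; the
    generalized inverse of a nondecreasing function is left-continuous; and the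
    quantile vanishes at [0], so that all the integrals for times up to [t] may
    be taken over the same interval [`]0, t]]. Monotone convergence
    concludes. *)

(** * Substituting an independent random element *)

Section independent_substitution.
Context {d d1 d2 d3 d'} {T : measurableType d} {T1 : measurableType d1}
  {T2 : measurableType d2} {T3 : measurableType d3} {U : measurableType d'}
  {R : realType}.
Variable P : probability T R.

Definition independent_elements {dA dB} {TA : measurableType dA}
    {TB : measurableType dB} (Y : T -> TA) (V : T -> TB) : Prop :=
  forall A B, measurable A -> measurable B ->
    P (Y @^-1` A `&` V @^-1` B) = (P (Y @^-1` A) * P (V @^-1` B))%E.

(** By independence the joint law of [Y] and [V] agrees with the product of
    their laws on rectangles, hence everywhere; the right-hand side is the
    integral over the sections of the preimage of [C]. *)
Lemma law_independent_substitution {dV} {TV : measurableType dV} (Y : T -> T1)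
    (V : T -> TV) (h : T1 * TV -> U) :
  measurable_fun [set: T] Y -> measurable_fun [set: T] V ->
  measurable_fun [set: T1 * TV] h -> independent_elements Y V ->
  forall C, measurable C ->
  P ((fun w => h (Y w, V w)) @^-1` C) =
    (\int[pushforward P Y]_z P ((fun w => h (z, V w)) @^-1` C))%E.
Proof.
move=> mY mV mh indep C mC.
have mYV := measurable_fun_pair mY mV.
pose Y' : {mfun T >-> T1} :=
  HB.pack_for {mfun T >-> T1} Y (isMeasurableFun.Build _ _ _ _ Y mY).
pose V' : {mfun T >-> TV} :=
  HB.pack_for {mfun T >-> TV} V (isMeasurableFun.Build _ _ _ _ V mV).
pose YV' : {mfun T >-> (T1 * TV)%type} :=
  HB.pack_for {mfun T >-> (T1 * TV)%type} (fun w => (Y w, V w))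
    (isMeasurableFun.Build _ _ _ _ (fun w => (Y w, V w)) mYV).
have mhC : measurable (h @^-1` C) by rewrite -[_ @^-1` _]setTI; exact: mh.
have /= prodE := @product_measure_unique _ _ _ _ _ (distribution P Y')
  (distribution P V') (distribution P YV') _ _ mhC.
rewrite -[LHS]/(distribution P YV' (h @^-1` C)) -prodE; last first.
  by move=> A B mA mB; rewrite /distribution /pushforward/= -indep.
apply: eq_integral => z _ /=; congr (P _).
by apply/seteqP; split => w /=; rewrite /xsection/= inE.
Qed.

(** Both sides are mixtures with the same mixing law and, at each fixed [z], the
    same component. [V] and [W] live in different spaces because two processes
    with the same marginals generate different sigma-algebras. *)
Lemma eq_dist_independent_substitution (Y Z : T -> T1) (V : T -> T2)
    (W : T -> T3) (h : T1 * T2 -> U) (k : T1 * T3 -> U) :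
  eq_dist P Y Z -> measurable_fun [set: T] V -> measurable_fun [set: T] W ->
  measurable_fun [set: T1 * T2] h -> measurable_fun [set: T1 * T3] k ->
  (forall z, eq_dist P (fun w => h (z, V w)) (fun w => k (z, W w))) ->
  independent_elements Y V -> independent_elements Z W ->
  eq_dist P (fun w => h (Y w, V w)) (fun w => k (Z w, W w)).
Proof.
move=> [mY mZ YZ] mV mW mh mk hk indV indW.
split; [exact: measurableT_comp mh (measurable_fun_pair mY mV)|
        exact: measurableT_comp mk (measurable_fun_pair mZ mW)|].
move=> C mC; rewrite !law_independent_substitution//.
pose Y' : {mfun T >-> T1} :=
  HB.pack_for {mfun T >-> T1} Y (isMeasurableFun.Build _ _ _ _ Y mY).
pose Z' : {mfun T >-> T1} :=
  HB.pack_for {mfun T >-> T1} Z (isMeasurableFun.Build _ _ _ _ Z mZ).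
transitivity (\int[distribution P Z']_z P ((fun w => h (z, V w)) @^-1` C))%E.
  apply: (@eq_measure_integral _ _ _ _ (distribution P Z') (distribution P Y')).
  by move=> A mA _; exact: YZ.
by apply: eq_integral => z _; have [_ _ ->] := hk z.
Qed.

End independent_substitution.

(** * Joint measurability of monotone processes *)

(** The sample space with only the information carried by the process [f]; its
    measurable sets are those of [process_sigma_algebra f]. *)
Definition process_space {d d'} {T : measurableType d} {U : measurableType d'}
    {R : realType} (f : R -> T -> U) : Type :=
  g_sigma_algebraType
    [set A | exists (t : R) B, [/\ 0 <= t, measurable B & A = f t @^-1` B]].

HB.instance Definition _ d d' (T : measurableType d) (U : measurableType d')
    (R : realType) (f : R -> T -> U) := Measurable.on (process_space f).

(** Only nonnegative times matter; truncating at [0] gives a map defined on all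
    of [R] without losing anything. *)
Definition jointly_measurable {d d'} {T : measurableType d}
    {U : measurableType d'} {R : realType} (f : R -> T -> U) : Prop :=
  measurable_fun [set: R * process_space f]
    (fun p : R * process_space f => f (Num.max 0 p.1) p.2).

Section process_space.
Context {d d'} {T : measurableType d} {U : measurableType d'} {R : realType}.
Implicit Types f : R -> T -> U.

Lemma process_measurable_preimage f (t : R) (B : set U) : measurable B ->
  measurable ((f (Num.max 0 t) @^-1` B) : set (process_space f)).
Proof.
move=> mB; apply: sub_sigma_algebra; exists (Num.max 0 t), B; split => //.
by rewrite le_max lexx.
Qed.

Lemma measurable_process_space_id f :
  (forall t, 0 <= t -> measurable_fun [set: T] (f t)) ->
  measurable_fun [set: T] (id : T -> process_space f).
Proof.
move=> mf _ A mA; rewrite setTI preimage_id.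
apply: (smallest_sub (@sigma_algebra_measurable _ T)) mA => B.
by move=> [s [C [s0 mC ->]]]; rewrite -[_ @^-1` _]setTI; exact: mf.
Qed.

Lemma process_sigma_algebra_preimage f (t : R) (B : set U) :
  0 <= t -> measurable B -> process_sigma_algebra f (f t @^-1` B).
Proof. by move=> t0 mB; apply: sub_sigma_algebra; exists t, B. Qed.

End process_space.

Section joint_measurability.
Context {d} {T : measurableType d} {R : realType}.

(** If [a < f t w] and [0 < t] then also [a < f q w] for some rational [q < t],
    so superlevel sets are countable unions of rectangles. Time [0] cannot be
    approached from the left and contributes one more rectangle. *)
Lemma jointly_measurable_left (f : R -> T -> \bar R) :
  (forall w s t, 0 <= s -> s <= t -> (f s w <= f t w)%E) ->
  (forall w t (a : R), 0 < t -> (a%:E < f t w)%E ->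
    exists2 s, 0 <= s < t & (a%:E < f s w)%E) ->
  jointly_measurable f.
Proof.
move=> ndf lf mD; apply: (measurability _ (ErealGenOInfty.measurableE R)) => //.
move=> _ [_ [a ->] <-]; rewrite setTI.
rewrite (_ : _ @^-1` _ =
    ([set: R] `*` (f (Num.max 0 0) @^-1` `]a%:E, +oo[%classic)) `|`
    \bigcup_(q : rat) ([set` `]ratr q, +oo[%R] `*`
      (f (Num.max 0 (ratr q)) @^-1` `]a%:E, +oo[%classic))); last first.
  rewrite maxxx; apply/seteqP; split => -[z w] /=.
    rewrite in_itv/= andbT.
    have [z0|z0] := leP z 0; first by left; rewrite /= in_itv/= andbT.
    move=> /lf => /(_ z0)[s /andP[s0 sz] asw].
    have [q /[!in_itv]/= /andP[sq qz]] := rat_in_itvoo sz.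
    right; exists q => //=; rewrite !in_itv/= !andbT; split => //.
    by apply: (lt_le_trans asw); apply: ndf => //; rewrite le_max (ltW sq) orbT.
  case=> [[_]|[q _ [/=]]].
    rewrite !in_itv/= !andbT => aw.
    by apply: (lt_le_trans aw); apply: ndf; rewrite ?le_max lexx.
  rewrite !in_itv/= !andbT => qz aw.
  apply: (lt_le_trans aw); apply: ndf; first by rewrite le_max lexx.
  by rewrite ge_max !le_max lexx (ltW qz) orbT.
apply: measurableU.
  apply: measurableX => //; apply: process_measurable_preimage.
  exact: emeasurable_itv.
apply: bigcupT_measurable_rat => q.
apply: measurableX; first exact: measurable_itv.
by apply: process_measurable_preimage; exact: emeasurable_itv.
Qed.

(** If [f t w < a] then also [f q w < a] for some rational [q > t], so sublevel
    sets are countable unions of rectangles. *)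
Lemma jointly_measurable_right (f : R -> T -> R) :
  (forall w s t, 0 <= s -> s <= t -> f s w <= f t w) ->
  (forall w t, 0 <= t -> f s w @[s --> t^'+] --> f t w) ->
  jointly_measurable f.
Proof.
move=> ndf rf mD; apply: (measurability _ (RGenInftyO.measurableE R)) => //.
move=> _ [_ [a ->] <-]; rewrite setTI.
rewrite (_ : _ @^-1` _ =
    \bigcup_(q : rat) ([set` `]-oo, (ratr q : R)[%R] `*`
      (f (Num.max 0 (ratr q)) @^-1` `]-oo, a[%classic))); last first.
  apply/seteqP; split => -[z w] /=; rewrite ?in_itv/=.
    have z0 : 0 <= Num.max 0 z by rewrite le_max lexx.
    move=> fa; have [s zs fs] : exists2 s, Num.max 0 z < s & f s w < a.
      have : \forall s \near (Num.max 0 z)^'+, Num.max 0 z < s /\ f s w < a.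
        near=> s; split; near: s; first exact: nbhs_right_gt.
        exact: (cvgr_lt _ (rf w _ z0) _ fa).
      by move=> /filter_ex[s []]; exists s.
    have [q /[!in_itv]/= /andP[zq qs]] := rat_in_itvoo zs.
    exists q => //=; rewrite !in_itv/=; split.
      by apply: le_lt_trans zq; rewrite le_max lexx orbT.
    by rewrite max_r ?(le_lt_trans _ fs)// ?ndf// ltW// (le_lt_trans z0).
  move=> [q _ [/=]]; rewrite !in_itv/= => zq; apply: le_lt_trans; apply: ndf.
    by rewrite le_max lexx.
  by rewrite ge_max !le_max lexx (ltW zq) orbT.
apply: bigcupT_measurable_rat => q.
apply: measurableX; first exact: measurable_itv.
by apply: process_measurable_preimage; exact: measurable_itv.
Unshelve. all: by end_near. Qed.

End joint_measurability.

(** * Left-continuity of the quantile function and of the quantile clock *)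

Section quantile.
Context {R : realType}.
Implicit Types (F : R -> \bar R).

Lemma quantile_ge0 F u : (0 <= quantile F u)%E.
Proof. by apply: le_ereal_inf_tmp => _ [x [x0 _] <-]; rewrite lee_fin. Qed.

Lemma quantile0 F : (forall x, (0 <= F x)%E) -> quantile F 0 = 0%E.
Proof.
move=> F0; apply/eqP; rewrite eq_le quantile_ge0 andbT.
by apply: ereal_inf_lbound; exists 0 => //=; split.
Qed.

Lemma quantile_nondecreasing F u v :
  u <= v -> (quantile F u <= quantile F v)%E.
Proof.
move=> uv; apply: le_ereal_inf_tmp => _ [x [x0 vx] <-]; apply: ereal_inf_lbound.
exists x => //; split => //.
by apply: le_trans vx; rewrite lee_fin.
Qed.

(** Otherwise [quantile F v <= a] for all [v < u]. Take [b] with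
    [a < b < quantile F u]: then [F b] is at least every [v < u], hence at least
    [u], so that [quantile F u <= b], a contradiction. *)
Lemma quantile_left_continuous F u (a : R) :
  {homo F : x y / x <= y >-> (x <= y)%E} ->
  (a%:E < quantile F u)%E -> exists2 v, v < u & (a%:E < quantile F v)%E.
Proof.
move=> ndF auQ; apply: contrapT => noQ.
have Qle v : v < u -> (quantile F v <= a%:E)%E.
  by move=> vu; rewrite leNgt; apply/negP => av; apply: noQ; exists v.
have a0 : 0 <= a.
  rewrite -lee_fin; apply: le_trans (Qle (u - 1) _); first exact: quantile_ge0.
  by rewrite ltrBlDr ltrDl.
have [b [ab bQ]] : exists b : R, a < b /\ (b%:E < quantile F u)%E.
  case: (quantile F u) auQ => [r| |//]; last first.
    by exists (a + 1); rewrite ltrDl ltry.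
  rewrite lte_fin => ar; exists ((a + r) / 2); rewrite lte_fin.
  by rewrite !midf_lt.
have uF : (u%:E <= F b)%E.
  rewrite leNgt; apply/negP => Fu.
  have [v [Fv vu]] : exists v : R, (F b < v%:E)%E /\ v < u.
    case: (F b) Fu => [r| //|_]; last first.
      by exists (u - 1); rewrite ltNyr ltrBlDr ltrDl.
    rewrite lte_fin => ru; exists ((r + u) / 2); rewrite lte_fin.
    by rewrite !midf_lt.
  have /ereal_inf_lt[_ [x [x0 vx] <-]] : (quantile F v < b%:E)%E.
    by apply: le_lt_trans (Qle _ vu) _; rewrite lte_fin.
  rewrite lte_fin => /ltW xb.
  by have := lt_le_trans Fv (le_trans vx (ndF _ _ xb)); rewrite ltxx.
move: bQ; rewrite ltNge => /negP; apply; apply: ereal_inf_lbound.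
by exists b => //=; split => //; rewrite ltW// (le_lt_trans a0).
Qed.

End quantile.

Section quantile_clock_paths.
Context {d d'} {S : measurableType d} {T : measurableType d'} {R : realType}.
Context {Q : probability S R} {P : probability T R}.
Variables (X : {RV Q >-> R}) (L : subordinator P).

Let integrand (t s : R) : \bar R :=
  quantile (cdf X) (Num.max 0 (1 - s / t)).

Let integrand_ge0 t s : (0 <= integrand t s)%E.
Proof. exact: quantile_ge0. Qed.

Let integrand_nonincreasing t s s' :
  0 < t -> s <= s' -> (integrand t s' <= integrand t s)%E.
Proof.
move=> t0 ss'; apply: quantile_nondecreasing; apply: le_max2 => //.
by rewrite lerB// ler_pM2r// invr_gt0.
Qed.

Let integrand_nondecreasing t t' s : 0 <= s -> 0 < t -> t <= t' ->
  (integrand t s <= integrand t' s)%E.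
Proof.
move=> s0 t0 tt'; apply: quantile_nondecreasing; apply: le_max2 => //.
by rewrite lerB// ler_wpM2l// lef_pV2// posrE (lt_le_trans t0).
Qed.

Let integrand_eq0 t s : 0 < t -> t <= s -> integrand t s = 0%E.
Proof.
move=> t0 ts; rewrite /integrand max_l ?quantile0//.
by rewrite subr_le0 ler_pdivlMr// mul1r.
Qed.

Let measurable_integrand t D : 0 < t ->
  measurable_fun (D : set (measurableTypeR R)) (integrand t).
Proof.
move=> t0; apply: measurable_funTS => mT.
apply: (measurability _ (ErealGenOInfty.measurableE R)) => // _ [_ [a ->] <-].
rewrite setTI; apply: is_interval_measurable => s s' /=.
rewrite !in_itv/= !andbT => _ as' r /andP[_ rs'].
by rewrite in_itv/= andbT (lt_le_trans as')// integrand_nonincreasing.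
Qed.

Lemma quantile_clock_ge0 t w : (0 <= quantile_clock X L t w)%E.
Proof. by apply: integral_ge0 => s _; exact: quantile_ge0. Qed.

Lemma quantile_clock0 w : quantile_clock X L 0 w = 0%E.
Proof.
by rewrite /quantile_clock set_itv_ge ?bnd_simp ?ltxx// integral_set0.
Qed.

(** For [s >= t] the integrand is the quantile at [0], which is [0]. Enlarging
    the domain of integration puts clocks at different times on a common
    domain. *)
Let quantile_clock_widen t t' w : 0 < t -> t <= t' ->
  quantile_clock X L t w =
  (\int[lebesgue_stieltjes_measure (path_of L w)]_(s in `]0%R, t'])
     integrand t s)%E.
Proof.
move=> t0 tt'; rewrite /quantile_clock.
have -> : `]0, t]%classic = `]0, t'] `&` `]0, t]%classic :> set R.
  apply/seteqP; split => s /=; rewrite !in_itv/=; last by case.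
  by move=> /andP[-> st]; rewrite st (le_trans st).
rewrite integral_mkcondr; apply: eq_integral => s; rewrite inE/= in_itv/=.
move=> /andP[s0 st']; rewrite patchE; case: ifPn => //.
rewrite notin_setE/= in_itv/= s0/= => /negP; rewrite -ltNge => ts.
by rewrite integrand_eq0// ltW.
Qed.

Lemma quantile_clock_nondecreasing w s t :
  0 <= s -> s <= t -> (quantile_clock X L s w <= quantile_clock X L t w)%E.
Proof.
rewrite le_eqVlt => /predU1P[<- _|s0 st].
  by rewrite quantile_clock0 quantile_clock_ge0.
have t0 := lt_le_trans s0 st.
rewrite (quantile_clock_widen w s0 st) (quantile_clock_widen w t0 (lexx t)).
apply: ge0_le_integral => //; [exact: measurable_integrand..|].
move=> r; rewrite /= in_itv/= => /andP[r0 _].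
by apply: integrand_nondecreasing => //; exact: ltW.
Qed.

(** Along times [t_ n] increasing to [t], the integrands increase to the
    integrand at [t], so the integrals converge to the clock at [t]. *)
Lemma quantile_clock_left_continuous w t (a : R) :
  0 < t -> (a%:E < quantile_clock X L t w)%E ->
  exists2 s, 0 <= s < t & (a%:E < quantile_clock X L s w)%E.
Proof.
move=> t0 aT; apply: contrapT => noT.
pose t_ n := t * (1 - n.+2%:R^-1).
have t_gt0 n : 0 < t_ n.
  by rewrite mulr_gt0// subr_gt0 invf_lt1// ltr1n.
have t_lt n : t_ n < t by rewrite gtr_pMr// ltrBlDr ltrDl invr_gt0.
have t_nd : nondecreasing_seq t_.
  move=> m n mn; rewrite ler_pM2l// lerB// lef_pV2 ?posrE// ler_nat.
  by rewrite !ltnS.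
have t_cvg : t_ n @[n --> \oo] --> t.
  rewrite -[X in _ --> X]mulr1; apply: cvgMl_tmp.
  rewrite -[X in _ --> X]subr0; apply: cvgB; first exact: cvg_cst.
  have := @cvg_harmonic R; rewrite -(cvg_shiftS (@harmonic R)); exact.
have Tle n : (quantile_clock X L (t_ n) w <= a%:E)%E.
  rewrite leNgt; apply/negP => aTn; apply: noT; exists (t_ n) => //.
  by rewrite ltW//=.
have lim_integrand s : 0 < s ->
    limn (fun n => integrand (t_ n) s) = integrand t s.
  move=> s0; have nd : nondecreasing_seq (fun n => integrand (t_ n) s).
    move=> m n mn; apply: integrand_nondecreasing => //; first exact: ltW.
    exact: t_nd.
  apply/eqP; rewrite eq_le; apply/andP; split.
    apply: lime_le; first exact: ereal_nondecreasing_is_cvgn.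
    apply: nearW => n; apply: integrand_nondecreasing => //; exact: ltW.
  have [ts|st] := leP t s.
    rewrite integrand_eq0//; apply: lime_ge.
      exact: ereal_nondecreasing_is_cvgn.
    exact: nearW.
  rewrite leNgt; apply/negP => lim_lt.
  have le_lim n : (integrand (t_ n) s <= limn (fun n => integrand (t_ n) s))%E.
    rewrite (cvg_lim _ (ereal_nondecreasing_cvgn nd))//.
    by apply: ereal_sup_ubound; exists n.
  (* The limit is finite, so it can serve as the real bound in the
     left-continuity of the quantile. *)
  move: lim_lt le_lim; case: (limn _) => [r| |] lim_lt le_lim.
  - move: lim_lt; rewrite /integrand max_r; last first.
      by rewrite subr_ge0 ler_pdivrMr// mul1r ltW.
    move=> /(quantile_left_continuous (@cdf_nondecreasing _ _ _ _ X)).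
    move=> [v vu rv].
    have : \forall n \near \oo, v < 1 - s / t_ n.
      apply: cvgr_gt vu; apply: cvgB; first exact: cvg_cst.
      by apply: cvgMl_tmp; apply: cvgV => //; rewrite gt_eqF.
    move=> /filter_ex[n vn].
    have := le_lim n; rewrite leNgt => /negP; apply; apply: (lt_le_trans rv).
    by apply: quantile_nondecreasing; rewrite le_max (ltW vn) orbT.
  - by rewrite ltNge leey in lim_lt.
  - have := le_trans (integrand_ge0 (t_ 0%N) s) (le_lim 0%N).
    by rewrite leeNy_eq.
suff : (quantile_clock X L t w <= a%:E)%E by rewrite leNgt aT.
have -> : quantile_clock X L t w =
    (\int[lebesgue_stieltjes_measure (path_of L w)]_(s in `]0%R, t])
      limn (fun n => integrand (t_ n) s))%E.
  apply: eq_integral => s; rewrite inE/= in_itv/= => /andP[s0 _].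
  by rewrite lim_integrand.
rewrite monotone_convergence//; last 2 first.
- by move=> n; exact: measurable_integrand.
- move=> s; rewrite /= in_itv/= => /andP[s0 _] m n mn.
  by apply: integrand_nondecreasing; [exact: ltW| |exact: t_nd].
have int_t_ n : (\int[lebesgue_stieltjes_measure (path_of L w)]_(s in `]0%R, t])
    integrand (t_ n) s)%E = quantile_clock X L (t_ n) w.
  by rewrite (quantile_clock_widen w (t_gt0 n) (ltW (t_lt n))).
under eq_fun do rewrite int_t_.
apply: lime_le; last exact: nearW.
apply: ereal_nondecreasing_is_cvgn => m n mn.
by apply: quantile_clock_nondecreasing; [exact: ltW|exact: t_nd].
Qed.

End quantile_clock_paths.

(** * Subordination *)

Theorem proposition7p2 (R : realType)
    (dS : measure_display) (S : measurableType dS) (Q : probability S R)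
    (dT : measure_display) (T : measurableType dT) (P : probability T R)
    (X : {RV Q >-> R}) (L zeta1 zeta2 : subordinator P)
    (hXL : quantile_clock_parameters X L)
    (h1 : forall t : R, 0 <= t ->
       eq_dist P (quantile_clock X L t) (fun w => (zeta1 t w)%:E))
    (hindep_clock : independent_processes P zeta2 (quantile_clock X L))
    (hindep_zeta1 : independent_processes P zeta2 zeta1)
    (t : R) (ht : 0 <= t) :
  eq_dist P (fun w => quantile_clock X L (zeta2 t w) w)
            (fun w => (zeta1 (zeta2 t w) w)%:E) /\
  eq_dist P (fun w => zeta2 (fine (quantile_clock X L t w)) w)
            (fun w => zeta2 (zeta1 t w) w).
Proof.
have zeta_ge0 (z : subordinator P) s w : 0 <= s -> 0 <= z s w.
  by move=> s0; rewrite -(process0 z w) process_nondecreasing.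
have jzeta (z : subordinator P) : jointly_measurable z.
  apply: jointly_measurable_right.
    by move=> w r s; exact: process_nondecreasing.
  by move=> w s; exact: process_right_continuous.
have mid_clock : measurable_fun [set: T]
    (id : T -> process_space (quantile_clock X L)).
  by apply: measurable_process_space_id => s /h1[].
have mid_zeta (z : subordinator P) :
    measurable_fun [set: T] (id : T -> process_space z).
  by apply: measurable_process_space_id; exact: process_measurable.
split.
  have jclock : jointly_measurable (quantile_clock X L).
    apply: jointly_measurable_left; first exact: quantile_clock_nondecreasing.
    by move=> w s a; exact: quantile_clock_left_continuous.
  have mzeta2 := process_measurable zeta2 ht.
  have /measurable_EFinP jEzeta1 := jzeta zeta1.
  have -> : (fun w => quantile_clock X L (zeta2 t w) w) =
      (fun w => quantile_clock X L (Num.max 0 (zeta2 t w)) w).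
    by apply/funext => w; rewrite max_r// zeta_ge0.
  have -> : (fun w => (zeta1 (zeta2 t w) w)%:E) =
      (fun w => (zeta1 (Num.max 0 (zeta2 t w)) w)%:E).
    by apply/funext => w; rewrite max_r// zeta_ge0.
  apply: (eq_dist_independent_substitution _ mid_clock (mid_zeta zeta1)
    jclock jEzeta1).
  - by split.
  - move=> z; have z0 : 0 <= Num.max 0 z by rewrite le_max lexx.
    exact: (h1 _ z0).
  - move=> A B mA mB; apply: hindep_clock => //.
    exact: process_sigma_algebra_preimage.
  - move=> A B mA mB; apply: hindep_zeta1 => //.
    exact: process_sigma_algebra_preimage.
(* The clock may be infinite on a negligible event only, where [fine] sends it
   to [0]; as [zeta1 t] is finite, applying [fine] keeps the laws equal. *)
have eq_time : eq_dist P (fun w => fine (quantile_clock X L t w)) (zeta1 t).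
  have [mT mz Tz] := h1 t ht; split.
  - exact: measurableT_comp.
  - exact: process_measurable.
  - move=> B mB; have mfB : measurable (fine @^-1` B : set (\bar R)).
      by rewrite -[_ @^-1` _]setTI; exact: fine_measurable.
    exact: (Tz _ mfB).
have clock_ge0 w : 0 <= fine (quantile_clock X L t w).
  by apply: fine_ge0; exact: quantile_clock_ge0.
have -> : (fun w => zeta2 (fine (quantile_clock X L t w)) w) =
    (fun w => zeta2 (Num.max 0 (fine (quantile_clock X L t w))) w).
  by apply/funext => w; rewrite max_r.
have -> : (fun w => zeta2 (zeta1 t w) w) =
    (fun w => zeta2 (Num.max 0 (zeta1 t w)) w).
  by apply/funext => w; rewrite max_r// zeta_ge0.
apply: (eq_dist_independent_substitution eq_time (mid_zeta zeta2)
  (mid_zeta zeta2) (jzeta zeta2) (jzeta zeta2)).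
- have mzeta2 z : measurable_fun [set: T] (zeta2 (Num.max 0 z)).
    by apply: process_measurable; rewrite le_max lexx.
  by move=> z; split; [exact: mzeta2|exact: mzeta2|].
- move=> A B mA mB; rewrite setIC muleC; apply: hindep_clock => //.
  apply: (process_sigma_algebra_preimage (B := fine @^-1` A) ht).
  by rewrite -[_ @^-1` _]setTI; exact: fine_measurable.
- move=> A B mA mB; rewrite setIC muleC; apply: hindep_zeta1 => //.
  exact: process_sigma_algebra_preimage.
Qed.
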